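(* Let $n\ge 1$ and consider the SOS game on a $1\times n$ grid. The first player wins when $n\ge 7$ and $n$ is odd. The second player wins when $n\ge 16$ and $n$ is even. For all other $n$, the game is a draw.
   Context: SOS game: on a $1\times n$ grid, initially empty, two players alternately write either an S or an O in an empty cell. The first player whose move produces three consecutive cells spelling SOS wins (no matter who wrote the individual letters). The game is a draw if all cells are filled without producing SOS. Both players are assumed to play optimally: ''a player wins'' means that this player has a winning strategy, and ''the game is a draw'' means that each player has a strategy guaranteeing that they do not lose. *)

(* Defs.v *)
From HB Require Import structures.
From mathcomp Require Import all_boot.

Set Implicit Arguments.
Unset Strict Implicit.
Unset Printing Implicit Defensive.

Inductive letter := letterS | letterO.

Definition bool_of_letter (l : letter) : bool :=
  if l is letterS then true else false.
Definition letter_of_bool (b : bool) : letter :=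
  if b then letterS else letterO.
Lemma bool_of_letterK : cancel bool_of_letter letter_of_bool.
Proof. by case. Qed.

HB.instance Definition _ := Finite.copy letter (can_type bool_of_letterK).

Inductive player := First | Second.

Definition opponent (P : player) : player :=
  if P is First then Second else First.

Definition grid (n : nat) := {ffun 'I_n -> option letter}.

Definition empty_grid (n : nat) : grid n := [ffun=> None].

Definition move (n : nat) : Type := ('I_n * letter)%type.

Definition legal n (g : grid n) (m : move n) : bool := g m.1 == None.

Definition place n (g : grid n) (m : move n) : grid n :=
  [ffun i => if i == m.1 then Some m.2 else g i].

Definition has_SOS n (g : grid n) : bool :=
  [exists i : 'I_n, exists j : 'I_n, exists k : 'I_n,
    [&& val j == (val i).+1, val k == (val j).+1,
        g i == Some letterS, g j == Some letterO & g k == Some letterS]].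

Definition is_full n (g : grid n) : bool := [forall i, g i != None].

Definition is_over n (g : grid n) : bool := has_SOS g || is_full g.

(* A history lists the moves made so far, oldest first. *)
Definition history (n : nat) := seq (move n).

Definition position n (h : history n) : grid n :=
  foldl (@place n) (empty_grid n) h.

Definition to_move n (h : history n) : player :=
  if odd (size h) then Second else First.

(* Play stops at the first SOS, so an SOS in the position reached by a history
   was produced by its last move, which was made by the player who is not to
   move. *)
Definition winner n (h : history n) : option player :=
  if has_SOS (position h) then Some (opponent (to_move h)) else None.

Definition strategy (n : nat) := history n -> move n.

(* The histories that can arise when P plays according to sigma and the
   opponent makes arbitrary legal moves. *)
Inductive follows n (P : player) (sigma : strategy n) : history n -> Prop :=
| follows_start : follows P sigma [::]
| follows_own h :
    follows P sigma h -> ~~ is_over (position h) ->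
    to_move h = P -> follows P sigma (rcons h (sigma h))
| follows_opponent h m :
    follows P sigma h -> ~~ is_over (position h) ->
    to_move h = opponent P -> legal (position h) m ->
    follows P sigma (rcons h m).

(* The first conjunct excludes strategies that prescribe writing in an
   occupied cell. *)
Definition can_guarantee (n : nat) (P : player)
    (goal : option player -> Prop) : Prop :=
  exists sigma : strategy n,
    (forall h, follows P sigma h -> ~~ is_over (position h) ->
       to_move h = P -> legal (position h) (sigma h)) /\
    (forall h, follows P sigma h -> is_over (position h) -> goal (winner h)).

Definition player_wins (n : nat) (P : player) : Prop :=
  can_guarantee n P (fun w => w = Some P).

Definition game_is_draw (n : nat) : Prop :=
  forall P : player, can_guarantee n P (fun w => w <> Some (opponent P)).

(* Main.v *)
Require Import Defs.
From mathcomp Require Import all_boot.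
From mathcomp Require Import zify.

Set Implicit Arguments.
Unset Strict Implicit.
Unset Printing Implicit Defensive.

(** Call a position calm when it contains no SOS and no single move completes one.
    The board is studied as a row of cells, with every cell off the board read as
    an O: such an O never takes part in an SOS, so edges need no separate treatment.

    Everything rests on a parity argument around the pattern S _ _ S, a trap:
    whatever is written in either of its two blanks lets the next player complete
    SOS.  In a calm position a blank outside every trap can be filled, with one
    letter or the other, so that the position stays calm ([calm_reply]).  Two traps
    never share a blank, so the blanks inside traps are even in number, and a
    player who moves with an odd number of blanks on the board always has such a
    safe move ([calm_free_cell]).  That player therefore never loses, and wins as
    soon as one trap is on the board: a trap cannot be filled without giving a win
    away, so the opponent is the one who runs out of safe moves ([endgame]).  The
    player with this parity is First when n is odd and Second when n is even.

    What is left is to create a trap.  An S with three free cells on each side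
    threatens to become a trap in two ways, and one move cannot spoil both
    ([fork]).  First has room for this when n is odd and at least 7
    ([first_wins_odd]), Second when n is even and at least 16, wherever First
    starts ([second_wins_even]).

    For smaller n the other player must prevent traps.  Once no four consecutive
    cells can become a trap any more, the position is dead, every blank is outside
    the traps, and the parity no longer matters.  For even n up to 14 First reaches
    a dead position by writing only the letter O, beginning next to the middle; an
    exhaustive search over the replies of Second checks it, and likewise for Second
    when n is 1, 3 or 5 ([holds_secures]).

    Strategies enter only at the end: [secures] is the minimax value of a row, and
    [secures_guarantee] turns it into a strategy for the game. *)

(** * Rows and their patterns *)

Notation row := (seq (option letter)).
Notation S' := (Some letterS).
Notation O' := (Some letterO).

Definition cell (b : row) (i : nat) : option letter := nth O' b i.

Definition write (b : row) (i : nat) (l : letter) : row :=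
  set_nth O' b i (Some l).

(** The patterns are given by matching, and not with boolean equality, because the
    search below evaluates them many thousands of times. *)
Definition sos3 (x y z : option letter) : bool :=
  match x, y, z with S', O', S' => true | _, _, _ => false end.

Definition hot3 (x y z : option letter) : bool :=
  match x, y, z with
  | S', O', S' | None, O', S' | S', None, S' | S', O', None => true
  | _, _, _ => false
  end.

Definition trap4 (x y z w : option letter) : bool :=
  match x, y, z, w with S', None, None, S' => true | _, _, _, _ => false end.

(** Writing only ever replaces blanks, so these are the quadruples from which
    [trap4] can still be reached. *)
Definition open4 (x y z w : option letter) : bool :=
  match x, y, z, w with
  | (S' | None), None, None, (S' | None) => true
  | _, _, _, _ => false
  end.

Definition sos_at b i := sos3 (cell b i) (cell b i.+1) (cell b i.+2).
Definition hot_at b i := hot3 (cell b i) (cell b i.+1) (cell b i.+2).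
Definition trap_at b i := trap4 (cell b i) (cell b i.+1) (cell b i.+2) (cell b i.+3).
Definition open_at b i := open4 (cell b i) (cell b i.+1) (cell b i.+2) (cell b i.+3).

Definition has_sos b := has (sos_at b) (iota 0 (size b)).
Definition calm b := ~~ has (hot_at b) (iota 0 (size b)).
Definition has_trap b := has (trap_at b) (iota 0 (size b)).
Definition openings b := count (open_at b) (iota 0 (size b)).
Definition dead b := openings b == 0.

Definition empties (b : row) := count (pred1 None) b.

Lemma cell_default b i : size b <= i -> cell b i = O'.
Proof. exact: nth_default. Qed.

Lemma empty_lt b i : cell b i = None -> i < size b.
Proof. by move=> e; rewrite ltnNge; apply/negP => /cell_default; rewrite e. Qed.

(** Off-board cells are O, so a pattern that does not begin with O can be looked
    for at all positions or only at those on the board. *)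
Lemma has_cells (p : nat -> bool) (b : row) :
  (forall i, p i -> cell b i <> O') ->
  reflect (exists i, p i) (has p (iota 0 (size b))).
Proof.
move=> hp; apply: (iffP hasP) => [[i _ pi]|[i pi]]; exists i => //.
rewrite mem_iota /= add0n ltnNge; apply/negP => /cell_default.
exact: hp.
Qed.

Lemma has_sosP b : reflect (exists i, sos_at b i) (has_sos b).
Proof. by apply: has_cells => i h e; rewrite /sos_at e in h. Qed.

Lemma calmP b : reflect (forall i, ~~ hot_at b i) (calm b).
Proof.
have /has_cells P : forall i, hot_at b i -> cell b i <> O'.
  by move=> i h e; rewrite /hot_at e in h.
apply: (iffP idP) => [/P h i|h]; first by apply/negP => hi; apply: h; exists i.
by apply/P => -[i]; apply/negP.
Qed.

Lemma has_trapP b : reflect (exists i, trap_at b i) (has_trap b).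
Proof. by apply: has_cells => i h e; rewrite /trap_at e in h. Qed.

Lemma deadP b : reflect (forall i, ~~ open_at b i) (dead b).
Proof.
have /has_cells P : forall i, open_at b i -> cell b i <> O'.
  by move=> i h e; rewrite /open_at e in h.
rewrite /dead /openings -leqn0 leqNgt -has_count.
apply: (iffP idP) => [/P h i|h]; first by apply/negP => hi; apply: h; exists i.
by apply/P => -[i]; apply/negP.
Qed.

Lemma cell_write b i l j :
  cell (write b i l) j = if j == i then Some l else cell b j.
Proof. by rewrite /cell /write nth_set_nth. Qed.

Lemma size_write b i l : cell b i = None -> size (write b i l) = size b.
Proof. by move/empty_lt => h; rewrite size_set_nth; apply/maxn_idPr. Qed.

Lemma empties_write b i l :
  cell b i = None -> empties b = (empties (write b i l)).+1.
Proof.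
rewrite /cell /write /empties.
elim: b i => [|x b IH] [|i] //= e; first by rewrite e /=.
by rewrite (IH i) // addnS.
Qed.

Lemma empties_gt0 b i : cell b i = None -> 0 < empties b.
Proof. by move/(empties_write letterO) ->. Qed.

Lemma has_empty b : 0 < empties b -> exists i, cell b i = None.
Proof.
rewrite /empties -has_count => /(has_nthP O')[i _ /eqP e]; by exists i.
Qed.

Lemma calm_no_sos b : calm b -> ~~ has_sos b.
Proof.
move/calmP => h; apply/has_sosP => -[i]; move: (h i).
by rewrite /hot_at /sos_at; case: (cell _ i) => [[]|]; case: (cell _ i.+1) => [[]|];
  case: (cell _ i.+2) => [[]|].
Qed.

(** Writing in the cell [x] of p q x c d affects only these three triples. *)
Definition calm_nbhd p q x c d := ~~ [|| hot3 p q x, hot3 q x c | hot3 x c d].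

(* Prepending off-board cells gives access to the left neighbours of cell i
   without subtraction. *)
Notation calm_around b i x :=
  (calm_nbhd (cell (O' :: O' :: b) i) (cell (O' :: b) i) x (cell b i.+1) (cell b i.+2)).

Lemma calm_aroundP b i : calm b -> calm_around b i (cell b i).
Proof.
move/calmP => h; rewrite /calm_nbhd.
case: i => [|[|i]]; rewrite !negb_or.
- by have := h 0; rewrite /hot_at /=; case: (cell b 0) => [[]|].
- have := h 0; have := h 1; rewrite /hot_at /= => -> ->.
  by case: (cell b 0) => [[]|].
by have := h i; have := h i.+1; have := h i.+2; rewrite /hot_at /= => -> -> ->.
Qed.

Lemma calm_write b i l : calm b -> calm_around b i (Some l) -> calm (write b i l).
Proof.
move=> /calmP h; rewrite /calm_nbhd !negb_or => /and3P[h1 h2 h3].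
apply/calmP => j; rewrite /hot_at !cell_write.
have [ei|ni] := eqVneq j i; first by subst j; rewrite !ifN //; lia.
have [ei|ni1] := eqVneq j.+1 i; first by subst i; rewrite ifN //; lia.
have [ei|ni2] := eqVneq j.+2 i; first by subst i.
exact: h.
Qed.

Lemma calm_no_sos_write b i l :
  calm b -> cell b i = None -> ~~ has_sos (write b i l).
Proof.
move=> /calmP h e; apply/has_sosP => -[j]; move: (h j) e.
rewrite /hot_at /sos_at !cell_write.
have [<-|n0] := eqVneq j i.
  rewrite !ifN; try lia.
  by case: l; repeat case: (cell _ _) => [[]|].
have [<-|n1] := eqVneq j.+1 i.
  rewrite !ifN; try lia.
  by case: l; repeat case: (cell _ _) => [[]|].
have [<-|n2] := eqVneq j.+2 i.
  by case: l; repeat case: (cell _ _) => [[]|].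
by repeat case: (cell _ _) => [[]|].
Qed.

(** A hot triple that is not an SOS is one letter short of it. *)
Lemma threat_exists b :
  ~~ has_sos b -> ~~ calm b -> exists i l, cell b i = None /\ has_sos (write b i l).
Proof.
move=> /has_sosP hs; rewrite negbK => /hasP[j _ hj].
have {}hs : ~~ sos_at b j by apply/negP => h; apply: hs; exists j.
suff [i [l [e h]]] : exists i l, cell b i = None /\ sos_at (write b i l) j.
  by exists i, l; split => //; apply/has_sosP; exists j.
move: hj hs; rewrite /hot_at /sos_at.
case e0 : (cell b j) => [[]|]; case e1 : (cell b j.+1) => [[]|];
  case e2 : (cell b j.+2) => [[]|] // _ _.
- exists j.+2, letterS; split => //.
  by rewrite !cell_write eqxx !ifN ?e0 ?e1 //; lia.
- exists j.+1, letterO; split => //.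
  by rewrite !cell_write eqxx !ifN ?e0 ?e2 //; lia.
- exists j, letterS; split => //.
  by rewrite !cell_write eqxx !ifN ?e1 ?e2 //; lia.
Qed.

(** * Traps and safe moves *)

Definition in_trap b i :=
  trap4 (cell (O' :: b) i) (cell b i) (cell b i.+1) (cell b i.+2)
  || trap4 (cell (O' :: O' :: b) i) (cell (O' :: b) i) (cell b i) (cell b i.+1).

(** A letter O is unsafe in a blank only if one neighbour is S and the other is
    blank; a letter S is then safe unless the cell after the blank neighbour is S,
    which makes S _ _ S. *)
Lemma calm_reply b i :
  calm b -> cell b i = None -> ~~ in_trap b i -> exists l, calm (write b i l).
Proof.
move=> hb e; have := calm_aroundP i hb; rewrite /in_trap e.
suff H p q c d : calm_nbhd p q None c d ->
    ~~ (trap4 q None c d || trap4 p q None c) ->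
    exists l, calm_nbhd p q (Some l) c d.
  by move=> h1 h2; have [l hl] := H _ _ _ _ h1 h2; exists l; apply: calm_write.
case: p => [[]|]; case: q => [[]|]; case: c => [[]|]; case: d => [[]|] //= _ _;
  by [exists letterO | exists letterS].
Qed.

Lemma in_trap_trap_at b i : in_trap b i -> cell b i = None ->
  exists2 j, trap_at b j & i = j.+1 \/ i = j.+2.
Proof.
rewrite /in_trap /trap_at => h e; move: h; rewrite e.
case: i e => [|[|i]] e /orP[] // h.
- by exists 0; [rewrite e | left].
- by exists i.+1; [rewrite e | left].
- by exists i; [rewrite e | right].
Qed.

(** The blanks inside traps are the first and the second blanks of the traps; no
    blank is both, since its left neighbour would be at once S and blank.  They are
    thus even in number. *)
Lemma calm_free_cell b : calm b -> odd (empties b) ->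
  exists2 i, cell b i = None & ~~ in_trap b i.
Proof.
move=> hb; pose E := [seq i <- iota 0 (size b) | cell b i == None].
have sE : empties b = size E.
  rewrite /empties /E size_filter -{1}(mkseq_nth O' b) /mkseq count_map.
  by apply: eq_count => i.
have memE i : (i \in E) = (cell b i == None).
  rewrite mem_filter mem_iota /= add0n andb_idr // => /eqP; exact: empty_lt.
have [/hasP[i]|no] := boolP (has (fun i => ~~ in_trap b i) E).
  by rewrite memE => /eqP e h; exists i.
pose T := [seq i <- iota 0 (size b) | trap_at b i].
have memT i : (i \in T) = trap_at b i.
  rewrite mem_filter mem_iota /= add0n andb_idr // => h.
  by rewrite ltnNge; apply/negP => /cell_default e; rewrite /trap_at e in h.
have uT : uniq T by rewrite filter_uniq ?iota_uniq.
have trapE j : trap_at b j ->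
    [/\ cell b j = S', cell b j.+1 = None, cell b j.+2 = None & cell b j.+3 = S'].
  rewrite /trap_at; case: (cell _ _) => [[]|] //; case: (cell _ _) => [[]|] //;
  case: (cell _ _) => [[]|] //; by case: (cell _ _) => [[]|].
have : perm_eq E (map S T ++ map (fun i => i.+2) T).
  apply: uniq_perm.
  - by rewrite filter_uniq ?iota_uniq.
  - rewrite cat_uniq !map_inj_uniq ?uT; try by [move=> ? ? []].
    rewrite andbT /=; apply/hasPn => _ /mapP[j + ->]; rewrite memT => /trapE[_ e1 _ _].
    apply/negP => /mapP[k]; rewrite memT => /trapE[e0 _ _ _] [ek].
    by rewrite -ek e1 in e0.
  move=> i; rewrite memE mem_cat; apply/eqP/orP => [e|].
    have : in_trap b i by apply/negPn; move/hasPn: no; apply; rewrite memE e.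
    case/in_trap_trap_at => // j hj [] ->; [left|right]; apply/mapP; exists j => //;
    by rewrite memT.
  by case=> /mapP[j]; rewrite memT => /trapE[_ e1 e2 _] ->.
move/perm_size; rewrite size_cat !size_map => e.
by rewrite sE e addnn odd_double.
Qed.

(** Filling a blank of S _ _ S leaves S S _ S, S O _ S or a mirror image, none of
    them calm. *)
Lemma trap_write b i l :
  cell b i = None -> calm (write b i l) -> has_trap b -> has_trap (write b i l).
Proof.
move=> e /calmP hc /has_trapP[j hj]; apply/has_trapP; exists j.
have := hc j; have := hc j.+1; move: hj e {hc}.
rewrite /trap_at /hot_at !cell_write.
have [<-|n0] := eqVneq j i; first by move=> + e0; rewrite e0.
have [<-|n1] := eqVneq j.+1 i.
  rewrite !ifN; try lia.
  by case: (cell b j) => [[]|]; case: (cell b j.+1) => [[]|];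
    case: (cell b j.+2) => [[]|]; case: (cell b j.+3) => [[]|]; case: l.
have [<-|n2] := eqVneq j.+2 i.
  rewrite !ifN; try lia.
  by case: (cell b j) => [[]|]; case: (cell b j.+1) => [[]|];
    case: (cell b j.+2) => [[]|]; case: (cell b j.+3) => [[]|]; case: l.
have [<-|//] := eqVneq j.+3 i.
by case: (cell b j) => [[]|]; case: (cell b j.+1) => [[]|];
    case: (cell b j.+2) => [[]|]; case: (cell b j.+3) => [[]|]; case: l.
Qed.

Lemma dead_write b i l : cell b i = None -> dead b -> dead (write b i l).
Proof.
move=> e /deadP h; apply/deadP => j; move: (h j); apply: contraNN.
have le k : cell (write b i l) k = cell b k \/ cell b k = None /\ cell (write b i l) k = Some l.
  by rewrite cell_write; case: eqP => [->|]; [right|left].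
rewrite /open_at.
by move: (le j) (le j.+1) (le j.+2) (le j.+3) =>
  [->|[-> ->]] [->|[-> ->]] [->|[-> ->]] [->|[-> ->]];
  case: l {le} => //; repeat case: (cell _ _) => [[]|].
Qed.

Lemma dead_not_in_trap b i : dead b -> cell b i = None -> ~~ in_trap b i.
Proof.
move=> /deadP h e; apply/negP => /in_trap_trap_at/(_ e)[j hj _]; move: (h j) hj.
rewrite /open_at /trap_at.
by repeat case: (cell _ _) => [[]|].
Qed.

(** * The game on rows *)

Definition moves (b : row) : seq (nat * letter) :=
  [seq (i, l) | i <- [seq i <- iota 0 (size b) | cell b i == None],
                l <- [:: letterS; letterO]].

Lemma mem_moves b i l : ((i, l) \in moves b) = (cell b i == None).
Proof.
apply/allpairsP/idP => [[[j k] /= [+ _ [-> _]]]|e].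
  by rewrite mem_filter => /andP[].
exists (i, l); split => //=; last by case: l.
by rewrite mem_filter e mem_iota /= add0n empty_lt //; apply/eqP.
Qed.

(** The minimax value of the game on b with d blanks left, for the player who is to
    move exactly when [mine] holds; a draw counts as success unless [win] is
    requested.  An SOS found on the board was made by the player not to move. *)
Fixpoint secures (win : bool) (d : nat) (mine : bool) (b : row) : bool :=
  if has_sos b then ~~ mine
  else if d is d'.+1 then
    let next m := secures win d' (~~ mine) (write b m.1 m.2) in
    if mine then has next (moves b) else all next (moves b)
  else ~~ win.

Lemma secures_mine win d b i l :
  ~~ has_sos b -> cell b i = None -> secures win d false (write b i l) ->
  secures win d.+1 true b.
Proof.
move=> /negbTE /= -> e h; apply/hasP; exists (i, l) => //.
by rewrite mem_moves e.
Qed.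

Lemma secures_theirs win d b :
  ~~ has_sos b ->
  (forall i l, cell b i = None -> secures win d true (write b i l)) ->
  secures win d.+1 false b.
Proof.
move=> /negbTE /= -> h; apply/allP => -[i l]; rewrite mem_moves => /eqP.
exact: h.
Qed.

Lemma secures_sos win d b : has_sos b -> secures win d false b.
Proof. by case: d => [|d] /= ->. Qed.

Lemma secures_threat win d b :
  ~~ has_sos b -> ~~ calm b -> secures win d.+1 true b.
Proof.
move=> hs hc; have [i [l [e h]]] := threat_exists hs hc.
by apply: (secures_mine (l := l) hs e); apply: secures_sos.
Qed.

(** The invariant kept by the player: the number of blanks is odd at each of the
    player's turns, or the position is dead; either way there is a blank outside
    the traps whenever the opponent has not just offered an SOS.  A trap survives
    every calm move, so if there is one then the board is never full at the end of
    a calm sequence and a draw is excluded. *)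
Lemma endgame (win : bool) d (mine : bool) b :
  empties b = d -> ~~ has_sos b -> mine || calm b ->
  (calm b -> win -> has_trap b) -> (odd d = mine) \/ dead b ->
  secures win d mine b.
Proof.
elim: d mine b => [|d IH] mine b hd hs hc ht hp.
  rewrite /= (negbTE hs); apply/negP => hw.
  have [hb|nb] := boolP (calm b); last first.
    by have [i [l [/empties_gt0]]] := threat_exists hs nb; rewrite hd.
  have /has_trapP[i] := ht hb hw; rewrite /trap_at.
  case e : (cell b i.+1) => [[]|]; try by case: (cell b i) => [[]|].
  by move/empties_gt0: e; rewrite hd.
case: mine hc hp => [_|/= hb] hp; last first.
  apply: secures_theirs => // i l e.
  apply: IH => //.
  - by apply/succn_inj; rewrite -hd -empties_write.
  - exact: calm_no_sos_write.
  - by move=> hc hw; apply: trap_write => //; exact: ht.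
  - by case: hp => [h|/dead_write h]; [left; exact: negbFE h|right; exact: h].
have [hb|nb] := boolP (calm b); last exact: secures_threat.
have [i e ni] : exists2 i, cell b i = None & ~~ in_trap b i.
  case: hp => [ho|hdead]; first by apply: calm_free_cell; rewrite // hd ho.
  have [|i e] := has_empty (b := b); first by rewrite hd.
  by exists i => //; apply: dead_not_in_trap.
have [l hl] := calm_reply hb e ni.
apply: (secures_mine hs e (l := l)); apply: IH => //.
- by apply/succn_inj; rewrite -hd -empties_write.
- exact: calm_no_sos.
- by move=> _ hw; apply: trap_write => //; exact: ht.
- by case: hp => [h|/dead_write h]; [left; exact: negbTE h|right; exact: h].
Qed.

(** * Opening moves *)

(** The triple with the new S in the middle is never hot. *)
Lemma calm_write_S b i :
  calm b ->
  (forall j, i = j.+2 -> ~~ hot3 (cell b j) (cell b j.+1) S') ->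
  ~~ hot3 S' (cell b i.+1) (cell b i.+2) -> calm (write b i letterS).
Proof.
move=> /calmP h hl hr; apply/calmP => j; rewrite /hot_at !cell_write.
have [->|n0] := eqVneq j i; first by rewrite !ifN //; lia.
have [<-|n1] := eqVneq j.+1 i.
  by rewrite !ifN; try lia; repeat case: (cell _ _) => [[]|].
have [e|n2] := eqVneq j.+2 i; first exact: hl.
exact: h.
Qed.

(** The S at q + 3 forms a trap with a second S at q or at q + 6.  The opponent's
    move leaves one of the two sides untouched; the last two hypotheses say that
    the new S gives no winning move further out. *)
Lemma fork b q :
  calm b -> ~~ odd (empties b) -> cell b q.+3 = S' ->
  [/\ cell b q = None, cell b q.+1 = None & cell b q.+2 = None] ->
  [/\ cell b q.+4 = None, cell b q.+4.+1 = None & cell b q.+4.+2 = None] ->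
  (forall j, q = j.+2 -> ~~ hot3 (cell b j) (cell b j.+1) S') ->
  ~~ hot3 S' (cell b q.+4.+3) (cell b q.+4.+4) ->
  secures true (empties b) false b.
Proof.
move=> hb ev e3 [e0 e1 e2] [e4 e5 e6] hl hr.
rewrite (empties_write letterO e0); apply: secures_theirs; first exact: calm_no_sos.
move=> i l ei.
have Ei : empties (write b q letterO) = empties (write b i l).
  by apply: succn_inj; rewrite -!empties_write.
have hs : ~~ has_sos (write b i l) by exact: calm_no_sos_write.
have nq : i != q.+3 by apply/eqP => e; rewrite e e3 in ei.
have build k : cell (write b i l) k = None -> calm (write (write b i l) k letterS) ->
    has_trap (write (write b i l) k letterS) ->
    secures true (empties (write b i l)) true (write b i l).
  move=> ek hc ht; rewrite (empties_write letterS ek).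
  apply: (secures_mine hs ek); apply: endgame => //; first exact: calm_no_sos.
  left; apply: negbTE; move: ev.
  by rewrite (empties_write l ei) (empties_write letterS ek) /= negbK.
rewrite Ei; have [hc|nc] := boolP (calm (write b i l)); last first.
  have : 0 < empties (write b i l).
    have [j [m [/empties_gt0 //]]] := threat_exists hs nc.
  by case: (empties _) => // d _; apply: secures_threat.
have [lt|gt|e] := ltngtP i q.+3; last by rewrite e eqxx in nq.
  apply: (build q.+4.+2).
  - by rewrite cell_write ifN //; lia.
  - apply: calm_write_S => //.
      by move=> j [<-]; rewrite !cell_write !ifN ?e4 ?e5 //; lia.
    by move: hr; rewrite !cell_write !ifN //; lia.
  apply/has_trapP; exists q.+3.
  by rewrite /trap_at !cell_write eqxx !ifN ?e3 ?e4 ?e5 //; lia.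
apply: (build q).
- by rewrite cell_write ifN //; lia.
- apply: calm_write_S => //.
    by move=> j ej; have := hl _ ej; rewrite !cell_write !ifN //; lia.
  by rewrite !cell_write !ifN ?e1 ?e2 //; lia.
apply/has_trapP; exists q.
by rewrite /trap_at !cell_write eqxx !ifN ?e1 ?e2 ?e3 //; lia.
Qed.

Definition blank n : row := nseq n None.

Lemma cell_blank n i : cell (blank n) i = if i < n then None else O'.
Proof. exact: nth_nseq. Qed.

Lemma empties_blank n : empties (blank n) = n.
Proof. by rewrite /empties count_nseq mul1n. Qed.

Lemma calm_blank n : calm (blank n).
Proof.
by apply/calmP => i; rewrite /hot_at !cell_blank; repeat case: ifP.
Qed.

(* Computes the cells of a row obtained from a blank one by a few writes: each
   comparison of indices is split and arithmetic discards the impossible cases.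
   Hypotheses on whole rows and on parity only slow arithmetic down. *)
Ltac decide_cells :=
  repeat match goal with
  | H : context [empties _] |- _ => clear H
  | H : context [calm _] |- _ => clear H
  | H : context [has_sos _] |- _ => clear H
  | H : context [odd _] |- _ => clear H
  end;
  rewrite /trap_at ?cell_write ?cell_blank;
  repeat (case: ifP => [?|?]; first [done | lia | idtac]); first [done | lia].

Lemma parity_secures_draw n mine :
  odd n = mine -> secures false n mine (blank n).
Proof.
move=> e; apply: endgame; rewrite ?empties_blank //; last by left.
  by apply: calm_no_sos; apply: calm_blank.
by rewrite calm_blank orbT.
Qed.

Lemma first_wins_odd n : 7 <= n -> odd n -> secures true n true (blank n).
Proof.
move=> n7 on; have hb := calm_blank n; have hs := calm_no_sos hb.
have e3 : cell (blank n) 3 = None by decide_cells.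
have en := empties_write letterS e3; rewrite empties_blank in en.
rewrite {1}en; apply: (secures_mine hs e3).
apply: (@fork _ 0) => //; try split; try by decide_cells.
  by apply: calm_write_S => // [j [<-]|]; decide_cells.
by rewrite en /= in on.
Qed.

(** If First begins with an S, Second makes a trap from it at once.  If First
    begins with an O at p, Second prepares a fork at the far end of the board; 16
    cells are enough to keep p away from both of its sides. *)
Lemma second_wins_even n : 16 <= n -> ~~ odd n -> secures true n false (blank n).
Proof.
move=> n16 ev; have hb := calm_blank n; have hs := calm_no_sos hb.
have [m en] : exists m, n = m.+2 by exists n.-2; lia.
rewrite {1}en; apply: secures_theirs => // p l ep.
have pn : p < n by move: ep; rewrite cell_blank; case: ifP.
have hs1 := calm_no_sos_write l hb ep.
have E1 : empties (write (blank n) p l) = m.+1.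
  by have := empties_write l ep; rewrite empties_blank; lia.
have hc1 : calm (write (blank n) p l).
  apply/calmP => j; rewrite /hot_at !cell_write !cell_blank.
  by repeat case: ifP => ?; case: l {hs1 E1} => //; lia.
have reply k : cell (write (blank n) p l) k = None ->
    (empties (write (write (blank n) p l) k letterS) = m ->
     calm (write (write (blank n) p l) k letterS) ->
     secures true m false (write (write (blank n) p l) k letterS)) ->
    calm (write (write (blank n) p l) k letterS) ->
    secures true m.+1 true (write (blank n) p l).
  move=> ek H hc; apply: (secures_mine hs1 ek); apply: H => //.
  by apply: succn_inj; rewrite -empties_write.
have evm : ~~ odd m by rewrite en /= negbK in ev.
case: l {hs1} hc1 E1 reply => hc1 E1 reply.
  have trapped k : [|| k == p + 3 | p == k + 3] -> k < n ->
     secures true m.+1 true (write (blank n) p letterS).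
    move=> kp kn; apply: (reply k); first by decide_cells.
      move=> e hc; apply: endgame => //; try by [exact: calm_no_sos|left; exact: negbTE].
      move=> _ _; apply/has_trapP; exists (minn k p).
      by case: (leqP k p) => ?; decide_cells.
    by apply: calm_write_S => // [j ej|]; decide_cells.
  have [lt|ge] := ltnP p 8; first by apply: (trapped (p + 3)); lia.
  by apply: (trapped (p - 3)); lia.
have [lt|ge] := ltnP p 8.
  apply: (reply (n - 4)); first by decide_cells.
    move=> e hc; rewrite -e; apply: (@fork _ (n - 7)) => //; rewrite ?e //; try split;
    try by decide_cells.
    by move=> j ej; decide_cells.
  by apply: calm_write_S => // [j ej|]; decide_cells.
apply: (reply 3); first by decide_cells.
  move=> e hc; rewrite -e; apply: (@fork _ 0) => //; rewrite ?e //; try split;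
  try by decide_cells.
by apply: calm_write_S => // [j ej|]; decide_cells.
Qed.

(** * Short boards *)

(** Trying first the cells whose filling leaves the fewest openings keeps the
    search below small. *)
Definition replies (b : row) : seq nat :=
  unzip2 (sort (fun x y => x.1 <= y.1)
    [seq (openings (write b i letterO), i) | i <- iota 0 (size b)]).

(** A lazy [has]: the disjunction inside [has] is evaluated on all of the list
    under call by value, whereas [find] stops at the first hit.  Nested
    conditionals replace boolean connectives in [holds] for the same reason. *)
Definition exists_in (T : Type) (p : T -> bool) (s : seq T) : bool :=
  find p s < size s.

(** A search for a way to reach a dead position by writing only O's; the opponent
    is to move in b, which should be calm.  A move that leaves b not calm needs no
    reply, as it gives a win away.  A trap made by the opponent refutes the line:
    giving up there loses no soundness and prunes the search. *)
Fixpoint holds (fuel : nat) (b : row) : bool :=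
  if dead b then true
  else if fuel is fuel'.+1 then
    ~~ exists_in (fun m => let c := write b m.1 m.2 in
         if calm c then
           if has_trap c then true
           else ~~ exists_in (fun i =>
             if cell c i is None then
               let c' := write c i letterO in
               if calm c' then holds fuel' c' else false
             else false) (replies c)
         else false) (moves b)
  else false.

Lemma holds_secures fuel b :
  calm b -> holds fuel b -> secures false (empties b) false b.
Proof.
have Hdead c : calm c -> dead c -> secures false (empties c) false c.
  by move=> hc hd; apply: endgame => //; [exact: calm_no_sos | right].
elim: fuel b => [|fuel IH] b hb /=; case: ifP => [hd _|_] //; try exact: Hdead.
rewrite /exists_in -has_find => /hasPn hr.
case eb : (empties b) => [|d].
  by rewrite /= (negbTE (calm_no_sos hb)).
apply: secures_theirs; first exact: calm_no_sos.
move=> i l e; have hs := calm_no_sos_write l hb e.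
have ed : empties (write b i l) = d by apply: succn_inj; rewrite -empties_write.
have := hr (i, l); rewrite mem_moves e eqxx => /(_ isT) /=.
case: ifP => [hc|/negbT nc _]; last first.
  have [j [k [/empties_gt0]]] := threat_exists hs nc.
  by rewrite ed; case: d {eb ed} => // d _ _; apply: secures_threat.
case: ifP => // _; rewrite negbK -has_find => /hasP[j _].
case ej : (cell _ j) => //; case: ifP => // hcj /(IH _ hcj) h.
rewrite -ed (empties_write letterO ej).
exact: secures_mine h.
Qed.

(** With at most 14 cells, an O here leaves at most 6 cells on its left, too few
    for a fork, and 7 on its right, where the left arm of a fork would need an S
    next to this O and so would offer _ O S to First. *)
Definition left_of_middle n := (n./2).-1.

Lemma first_draws_even n :
  n \in [:: 2; 4; 6; 8; 10; 12; 14] -> secures false n true (blank n).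
Proof.
pose b m := write (blank m) (left_of_middle m) letterO.
move=> hn; have /andP[hb hh] : calm (b n) && holds n (b n).
  by apply/(allP (a := fun m => calm (b m) && holds m (b m))): hn; vm_compute.
have e : cell (blank n) (left_of_middle n) = None.
  by rewrite cell_blank ifT // /left_of_middle; case: n hn {b hb hh} => // n _; lia.
have en := empties_write letterO e; rewrite empties_blank in en.
rewrite {1}en; apply: (secures_mine _ e); last exact: holds_secures hh.
by apply: calm_no_sos; apply: calm_blank.
Qed.

Lemma second_draws_odd n :
  n \in [:: 1; 3; 5] -> secures false n false (blank n).
Proof.
move=> hn; rewrite -{1}(empties_blank n).
apply: (holds_secures (fuel := n)); first exact: calm_blank.
by apply/(allP (a := fun m => holds m (blank m))): hn; vm_compute.
Qed.

(** * From rows to the game *)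
Definition row_of n (g : grid n) : row := codom g.

Lemma size_row_of n (g : grid n) : size (row_of g) = n.
Proof. by rewrite size_codom card_ord. Qed.

Lemma cell_row_of n (g : grid n) (i : 'I_n) : cell (row_of g) i = g i.
Proof.
rewrite /cell /row_of /codom /image_mem (nth_map i) ?size_enum_ord //.
by rewrite nth_ord_enum.
Qed.

Lemma row_of_empty n : row_of (empty_grid n) = blank n.
Proof.
apply: (@eq_from_nth _ O'); rewrite size_row_of ?size_nseq // => i lti.
by have := cell_row_of (empty_grid n) (Ordinal lti); rewrite ffunE nth_nseq lti.
Qed.

Lemma row_of_place n (g : grid n) (m : move n) :
  legal g m -> row_of (place g m) = write (row_of g) m.1 m.2.
Proof.
move=> /eqP hm; have e : cell (row_of g) m.1 = None by rewrite cell_row_of.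
apply: (@eq_from_nth _ O'); rewrite ?size_write // !size_row_of // => i lti.
have -> : i = Ordinal lti by [].
have := cell_write (row_of g) m.1 m.2 (Ordinal lti); rewrite /cell => ->.
by rewrite -/(cell _ _) -/(cell (row_of g) _) !cell_row_of ffunE -val_eqE.
Qed.

Lemma has_SOS_row n (g : grid n) : has_SOS g = has_sos (row_of g).
Proof.
apply/existsP/has_sosP => [[i /existsP[j /existsP[k]]]|[i]].
  case/and5P=> /eqP ej /eqP ek /eqP hi /eqP hj /eqP hk; exists i.
  by rewrite /sos_at -ej -ek !cell_row_of hi hj hk.
rewrite /sos_at; have [lt2|/leq_trans ge] := ltnP i.+2 n; last first.
  rewrite (@cell_default _ i.+2) ?size_row_of ?ge //.
  by repeat case: (cell _ _) => [[]|].
have lt1 := ltnW lt2; have lt0 := ltnW lt1.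
have := cell_row_of g (Ordinal lt0); have := cell_row_of g (Ordinal lt1).
have := cell_row_of g (Ordinal lt2) => /= -> -> -> h.
exists (Ordinal lt0); apply/existsP; exists (Ordinal lt1); apply/existsP.
exists (Ordinal lt2); rewrite !eqxx /=; move: h.
by case: (g _) => [[]|] //; case: (g _) => [[]|] //; case: (g _) => [[]|].
Qed.

Lemma is_full_row n (g : grid n) : is_full g = (empties (row_of g) == 0).
Proof.
rewrite -leqn0 leqNgt; apply/forallP/negP => [h /has_empty[i e]|h i].
  have := empty_lt e; rewrite size_row_of => lti.
  by have := h (Ordinal lti); rewrite -cell_row_of e.
by apply/eqP => e; apply: h; apply: (@empties_gt0 _ i); rewrite cell_row_of.
Qed.

Definition has_turn (P : player) (k : nat) : bool :=
  if P is First then ~~ odd k else odd k.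

Lemma has_turnP n P (h : history n) : reflect (to_move h = P) (has_turn P (size h)).
Proof. by apply: (iffP idP); rewrite /to_move; case: P => /=; case: odd. Qed.

(** The strategy plays any move after which the row is still secured.  The number
    of blanks is n minus the length of the history, so the fuel of [secures] runs
    out exactly when the board is full. *)
Lemma secures_guarantee n P (win : bool) (goal : option player -> Prop) :
  0 < n -> goal (Some P) -> (~~ win -> goal None) ->
  secures win n (has_turn P 0) (blank n) -> can_guarantee n P goal.
Proof.
case: n => // n _ gP gN h0; set N := n.+1 in h0 *.
pose good (h : history N) (m : move N) :=
  legal (position h) m &&
  secures win (N - size h).-1 false (row_of (place (position h) m)).
pose sigma (h : history N) : move N :=
  odflt (ord0, letterS) [pick m : 'I_N * letter | good h m].
pose inv (h : history N) := empties (row_of (position h)) = N - size h /\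
  secures win (N - size h) (has_turn P (size h)) (row_of (position h)).
have next (h : history N) (m : move N) : legal (position h) m ->
    empties (row_of (position h)) = N - size h -> 
    position (rcons h m) = place (position h) m /\
    N - size h = (N - size (rcons h m)).+1 /\
    empties (row_of (position (rcons h m))) = N - size (rcons h m).
  move=> hm he; have pr : position (rcons h m) = place (position h) m.
    by rewrite /position -cats1 foldl_cat.
  split=> //; have := hm => /eqP e.
  have e' : cell (row_of (position h)) m.1 = None by rewrite cell_row_of.
  move: he; rewrite pr row_of_place // (empties_write m.2 e') size_rcons; lia.
have turnS P' k : has_turn P' k.+1 = ~~ has_turn P' k by case: P' => /=.
have sigmaP h : inv h -> ~~ is_over (position h) -> to_move h = P ->
    good h (sigma h).
  case=> he hs; rewrite /is_over negb_or has_SOS_row is_full_row he.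
  case/andP=> /negbTE ns nf /has_turnP ht; move: hs nf.
  rewrite ht /sigma; case: pickP => [m //|no] /=.
  case E : (N - size h) => [|d] //=; rewrite ns => /hasP[[i l]].
  rewrite mem_moves => /eqP e hs _; have := empty_lt e.
  rewrite size_row_of => lti; have := no (Ordinal lti, l).
  have lg : legal (position h) (Ordinal lti, l).
    by rewrite /legal -cell_row_of /= e.
  by rewrite /good lg E row_of_place //= hs.
have invP h : follows P sigma h -> inv h.
  elim=> {h} [|h _ ih no ht|h m _ ih no ht lg].
  - by rewrite /inv /position /= subn0 row_of_empty empties_blank.
  - have /andP[lg hs] := sigmaP h ih no ht; have [pr [sz ee]] := next _ _ lg (proj1 ih).
    split=> //; rewrite pr size_rcons turnS (introT (has_turnP P h) ht).
    by move: hs; rewrite sz size_rcons.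
  have [pr [sz ee]] := next _ _ lg (proj1 ih); split=> //.
  case: ih => he; rewrite pr size_rcons turnS.
  have -> : has_turn P (size h) = false.
    by apply/negP => /has_turnP e; move: ht; rewrite e; case: (P).
  move: no; rewrite /is_over has_SOS_row negb_or => /andP[/negbTE ns _].
  rewrite sz size_rcons /= ns => /allP/(_ (val m.1, m.2)).
  rewrite row_of_place // mem_moves cell_row_of; apply; exact: lg.
exists sigma; split=> h /invP; first by move=> ih no ht; case/andP: (sigmaP h ih no ht).
case=> he hs; rewrite /is_over /winner has_SOS_row is_full_row he.
have [sos|ns] /= := boolP (has_sos _).
  have: ~~ has_turn P (size h) by move: hs; case: (N - _) => [|d] /=; rewrite sos.
  by rewrite /to_move /=; case: (P) gP => /=; case: odd.
move=> /eqP e; move: hs; rewrite e /= (negbTE ns); exact: gN.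
Qed.

Theorem theorem3 (n : nat) (hn : 1 <= n) :
  (7 <= n -> odd n -> player_wins n First) /\
  (16 <= n -> ~~ odd n -> player_wins n Second) /\
  (~ (7 <= n /\ odd n) -> ~ (16 <= n /\ ~~ odd n) -> game_is_draw n).
Proof.
split; [|split].
- move=> n7 on; apply: (secures_guarantee (win := true)) => //.
  exact: first_wins_odd.
- move=> n16 ev; apply: (secures_guarantee (win := true)) => //.
  exact: second_wins_even.
move=> not_odd not_even P; apply: (secures_guarantee (win := false)) => //.
  by case: P.
have [on|ev] := boolP (odd n); case: P => /=.
- exact: parity_secures_draw.
- apply: second_draws_odd; have : n < 7 by rewrite ltnNge; apply/negP => n7; apply: not_odd.
  by move: hn on {not_odd not_even}; do 7 case: n => [|n] //.
- apply: first_draws_even.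
  have : n < 16 by rewrite ltnNge; apply/negP => n16; apply: not_even.
  by move: hn ev {not_odd not_even}; do 16 case: n => [|n] //.
exact: parity_secures_draw (negbTE ev).
Qed.
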